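(* Consider the iterative sampling-and-optimization algorithm described in the context, applied to a query with $m$ predicates of unknown selectivity, an approximation factor $\alpha\ge1$ and a confidence threshold $\delta\in[0,1]$. Let $a$ be the common selectivity mean of the predicates and let $d=a\cdot(1-\alpha^{-1/(2m)})$. Then, under the assumptions listed in the context, an $\alpha$-optimal plan is found with confidence $\delta$ after taking $$\frac{m\cdot\log\bigl(2/(1-\sqrt[m]{\delta})\bigr)}{2\cdot d^2}$$ samples in total.
   Context: A query has alternative plans and $m$ predicates of unknown selectivity (the selectivity of a predicate is the fraction, between 0 and 1, of input data items satisfying it). A selectivity vector assigns a selectivity to each predicate; $s_1\preceq s_2$ denotes coordinatewise $\le$. A cost model assigns a cost to every pair of a plan and a selectivity vector and is monotone: if $s_1\preceq s_2$, then the cost of any fixed plan at $s_1$ is not higher than at $s_2$. A plan is optimal at $s$ if it has minimal cost at $s$ among all plans of the query. It is $\alpha$-optimal at $s$ if its cost at $s$ is at most $\alpha$ times the optimal cost at $s$, and $\alpha$-optimal in a region if it is so at each vector of the region. A cube with bounds $lb\preceq ub$ is the set of vectors $s$ with $lb\preceq s\preceq ub$. Sampling a predicate means evaluating it on randomly selected data items; its selectivity mean is the arithmetic mean of the samples collected for it. In each iteration the algorithm takes the plan that is optimal at the current vector of selectivity means, determines a cube containing the means in which this plan is $\alpha$-optimal, and computes the confidence that the true selectivity vector lies in this cube. It terminates and returns the plan once this confidence is at least $\delta$; otherwise it takes more samples. The confidence is a lower bound on the probability that the true selectivities lie in the cube, obtained from the two-sided Hoeffding inequality, treating the deviations of different predicates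 as independent: it is the product over the predicates $r$ of $\max(1-2\exp(-2d_r^2l_r),0)$, where $l_r$ is the number of samples collected for $r$ and $d_r$ is the minimal distance between the mean of $r$ and the two cube bounds for $r$. Assumptions of the analysis. (i) Maximal sensitivity assumption, required only locally in a small area around the true selectivity values: multiplying the selectivity of each of the $m$ predicates by a factor $f$ may multiply the cost of a plan by up to the factor $f^m$. As a consequence, a plan optimal at $s$ is $\alpha$-optimal in the cube bounded by $s\alpha^{-1/(2m)}$ and $s\alpha^{1/(2m)}$, called its minimal near-optimality cube. (ii) Pessimistically, plans are near-optimal only within this minimal cube, and the algorithm is able to establish near-optimality of the plan that is best for the current means at least within its minimal cube. (iii) All predicates have the same selectivity mean $a$, which stays fixed over the iterations (or: $a$ denotes the mean in the final iteration), and therefore the same minimal distance $d=a(1-\alpha^{-1/(2m)})$ between mean and cube bounds. (iv) Samples are distributed uniformly over the predicates. Here $\log$ is the natural logarithm. *)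

(* Defs.v *)
(* Written against MathComp-Analysis. *)
From HB Require Import structures.
From mathcomp Require Import all_boot all_order all_algebra.
From mathcomp Require Import all_classical all_reals all_analysis.
Import Order.TTheory GRing.Theory Num.Theory.
Import numFieldNormedType.Exports.
Set Implicit Arguments.
Unset Strict Implicit.
Unset Printing Implicit Defensive.
Local Open Scope classical_set_scope.
Local Open Scope ring_scope.

Section Vectors.
Variables (R : realType) (m : nat).
Implicit Types s lb ub : 'rV[R]_m.

Definition is_selectivity s := forall r, 0 <= s 0 r <= 1.

Definition vle s1 s2 := forall r, s1 0 r <= s2 0 r.

(* The bounds of a cube need not lie in [0, 1], but its points do: cost models
   are only meaningful on selectivity vectors. *)
Definition cube lb ub : set 'rV[R]_m :=
  [set s | [/\ is_selectivity s, vle lb s & vle s ub]].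

End Vectors.

Record query (R : realType) (m : nat) := Query {
  item : finType;
  item_gt0 : (0 < #|item|)%N;
  holds : 'I_m -> pred item;
  plan : finType;
  cost : plan -> 'rV[R]_m -> R;
  cost_monotone : forall p s1 s2,
    is_selectivity s1 -> is_selectivity s2 -> vle s1 s2 ->
    cost p s1 <= cost p s2 }.

Section Plans.
Variables (R : realType) (m : nat) (Q : query R m).
Implicit Types (s : 'rV[R]_m) (p : plan Q) (alpha : R).

Definition selectivity : 'rV[R]_m :=
  \row_r (#|[pred x | holds (q := Q) r x]|%:R / #|item Q|%:R).

Definition optimal p s := forall p', cost p s <= cost p' s.

Definition near_optimal alpha p s :=
  exists2 p', optimal p' s & cost p s <= alpha * cost p' s.

Definition near_optimal_in alpha p (A : set 'rV[R]_m) :=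
  forall s, A s -> near_optimal alpha p s.

(* The factor f is at least 1: for a factor below 1 the same inequality would,
   combined with its instance for f^-1, force the cost to be homogeneous. *)
Definition max_sensitive (U : set 'rV[R]_m) :=
  forall p s (f : R), 1 <= f ->
    is_selectivity s -> is_selectivity (f *: s) -> U s -> U (f *: s) ->
    cost p (f *: s) <= f ^+ m * cost p s.

Definition min_lb alpha s := alpha `^ (- (2 * m%:R)^-1) *: s.
Definition min_ub alpha s := alpha `^ ((2 * m%:R)^-1) *: s.
Definition min_cube alpha s := cube (min_lb alpha s) (min_ub alpha s).

End Plans.

(* State of the algorithm in one iteration: all the data items drawn so far for
   each predicate, the plan under consideration, and the bounds of the cube in
   which its near-optimality has been established. *)
Record iteration (R : realType) (m : nat) (Q : query R m) := Iteration {
  samples : 'I_m -> seq (item Q);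
  chosen : plan Q;
  lbound : 'rV[R]_m;
  ubound : 'rV[R]_m }.

Section Algorithm.
Variables (R : realType) (m : nat) (Q : query R m).
Implicit Types (it : iteration Q) (run : nat -> iteration Q) (delta : R).

Definition means it : 'rV[R]_m :=
  \row_r ((count (holds (q := Q) r) (samples it r))%:R
          / (size (samples it r))%:R).

Definition total_samples it : nat := (\sum_(r < m) size (samples it r))%N.

Definition established_cube it := cube (lbound it) (ubound it).

Definition min_dist it (r : 'I_m) : R :=
  Num.min `|means it 0 r - lbound it 0 r| `|ubound it 0 r - means it 0 r|.

(* Each factor is the two-sided Hoeffding lower bound on the probability that
   the true selectivity of r is within min_dist it r of its mean; the product
   treats the predicates as independent. *)
Definition confidence it : R :=
  \prod_(r < m)
    Num.max (1 - 2 * expR (- (2 * min_dist it r ^+ 2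
                                * (size (samples it r))%:R))) 0.

Definition returns_at delta run k :=
  delta <= confidence (run k)
  /\ forall j, (j < k)%N -> confidence (run j) < delta.

(* A run is described by an infinite sequence of iterations; those after the
   first one that meets the confidence threshold are not executed. Near-
   optimality of the chosen plan in the established cube is not required here:
   it is part of what has to be shown. *)
Definition algorithm_run run :=
  forall k,
  [/\ optimal (chosen (run k)) (means (run k)),
      forall r, prefix (samples (run k) r) (samples (run k.+1) r) &
      (total_samples (run k) < total_samples (run k.+1))%N].

(* Pessimism: the established cube is the minimal near-optimality cube of the
   current means, no larger and no smaller. *)
Definition establishes_minimal_cubes (alpha : R) run :=
  forall k, lbound (run k) = min_lb alpha (means (run k))
         /\ ubound (run k) = min_ub alpha (means (run k)).

Definition uniform_sampling run :=
  forall k (r r' : 'I_m),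
    size (samples (run k) r) = size (samples (run k) r').

End Algorithm.

(* Extended-real arithmetic, in which 2 / 0 = +oo: the number of samples is +oo
   exactly when delta = 1 or d = 0, and then no positive threshold is reached. *)
Definition sample_number (R : realType) (m : nat) (delta d : R) : \bar R :=
  (m%:R%:E * lne (2%:E / (1 - delta `^ (m%:R^-1))%:E) / (2 * d ^+ 2)%:E)%E.

(* Main.v *)
(* With c = alpha^(1/(2m)), costs grow by at most c^m from the lower bound of
   the minimal cube to the means, and again from the means to its upper bound,
   so a plan optimal at the means is within c^(2m) = alpha of optimal on the
   cube. With means a and l samples per predicate, every factor of the
   confidence is 1 - 2 exp(-2 d^2 l), so the confidence is at least delta iff
   this factor is at least the m-th root of delta; solving for m l gives the
   sample number. *)
Require Import Defs.
From HB Require Import structures.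
From mathcomp Require Import all_boot all_order all_algebra.
From mathcomp Require Import all_classical all_reals all_analysis.
From mathcomp Require Import lra.
Import Order.TTheory GRing.Theory Num.Theory.
Import numFieldNormedType.Exports.
Set Implicit Arguments.
Unset Strict Implicit.
Unset Printing Implicit Defensive.
Local Open Scope classical_set_scope.
Local Open Scope ring_scope.

Lemma powR_invnK (R : realType) (m : nat) (x : R) :
  (0 < m)%N -> 0 <= x -> (x `^ m%:R^-1) ^+ m = x.
Proof.
move=> m0 x0; rewrite -powR_mulrn ?powR_ge0// -powRrM mulVf ?powRr1//.
by rewrite pnatr_eq0 -lt0n.
Qed.

Lemma powR_ge1 (R : realType) (x y : R) : 1 <= x -> 0 <= y -> 1 <= x `^ y.
Proof. by move=> x1 y0; rewrite -(powRr0 x) ler_powR. Qed.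

Lemma optimal_exists (R : realType) (m : nat) (Q : query R m)
    (p : plan Q) (s : 'rV[R]_m) : exists p' : plan Q, optimal p' s.
Proof.
case: (@arg_minP _ _ _ p xpredT (fun p' => cost p' s) isT) => p' _ minp'.
by exists p' => p''; exact: minp'.
Qed.

Lemma means_is_selectivity (R : realType) (m : nat) (Q : query R m)
    (it : iteration Q) : is_selectivity (means it).
Proof.
move=> r; rewrite mxE divr_ge0//=.
(* Without samples the quotient has denominator 0, so the mean is 0 by convention. *)
have [->|s0] := posnP (size (samples it r)); first by rewrite invr0 mulr0.
by rewrite ler_pdivrMr ?ltr0n// mul1r ler_nat count_size.
Qed.

(* Raising all selectivities by f > 1 neither lowers the cost (monotonicity) nor
   raises it by more than f^m, which is impossible for a negative cost. *)
Lemma cost_ge0 (R : realType) (m : nat) (Q : query R m) (U : set 'rV[R]_m)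
    (p : plan Q) (s : 'rV[R]_m) (f : R) :
  (0 < m)%N -> max_sensitive Q U -> 1 < f -> is_selectivity s ->
  is_selectivity (f *: s) -> U s -> U (f *: s) -> 0 <= cost p s.
Proof.
move=> m0 sens f1 ss sfs Us Ufs.
have le_fs : cost p s <= cost p (f *: s).
  apply: (cost_monotone (q := Q)) => // r; rewrite mxE ler_peMl ?(ltW f1)//.
  by case/andP: (ss r).
have := le_trans le_fs (sens p s f (ltW f1) ss sfs Us Ufs).
rewrite -subr_ge0 -{2}[cost p s]mul1r -mulrBl pmulr_rge0//.
by rewrite subr_gt0 exprn_egt1 -?lt0n.
Qed.

Lemma min_lbE (R : realType) (m : nat) (alpha : R) (s : 'rV[R]_m) :
  min_lb alpha s = (alpha `^ (2 * m%:R)^-1)^-1 *: s.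
Proof. by rewrite /min_lb powRN. Qed.

Lemma min_cube_center (R : realType) (m : nat) (alpha : R) (s : 'rV[R]_m) :
  1 <= alpha -> is_selectivity s -> min_cube alpha s s.
Proof.
move=> a1 ss; have c1 : 1 <= alpha `^ (2 * m%:R)^-1.
  by rewrite powR_ge1// invr_ge0 mulr_ge0.
split=> // r; case/andP: (ss r) => s0 _.
  by rewrite min_lbE mxE ler_piMl// invf_le1// (lt_le_trans ltr01).
by rewrite mxE ler_peMl.
Qed.

(* Upwards, the plan is compared at min(c, 1/a) s rather than at c s, which may
   leave [0, 1]; this is where the coordinates of s have to be equal. *)
Lemma optimal_near_optimal (R : realType) (m : nat) (Q : query R m)
    (alpha a : R) (U : set 'rV[R]_m) (p : plan Q) :
  (0 < m)%N -> 1 <= alpha -> max_sensitive Q U ->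
  is_selectivity (const_mx a : 'rV[R]_m) ->
  min_cube alpha (const_mx a) `<=` U -> optimal p (const_mx a) ->
  near_optimal_in alpha p (min_cube alpha (const_mx a)).
Proof.
move=> m0 a1 sens ss subU optp t ct.
have [p' optp'] := optimal_exists p t; exists p' => //.
have /subU Us := min_cube_center a1 ss.
have [st lt tu] := ct; have {}lt := lt; have Ut := subU _ ct.
have /andP[a_ge0 a_le1] : 0 <= a <= 1 by have := ss (Ordinal m0); rewrite mxE.
set c := alpha `^ (2 * m%:R)^-1.
have c1 : 1 <= c by rewrite powR_ge1// invr_ge0 mulr_ge0.
have c0 : 0 < c by apply: lt_le_trans c1.
have cm : c ^+ m * c ^+ m = alpha.
  rewrite -exprD addnn -mul2n /c -natrM powR_invnK ?muln_gt0//.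
  by rewrite (le_trans ler01).
rewrite min_lbE -/c in lt; rewrite /min_ub -/c in tu.
(* For [a = 0] the cube is the single point 0. This point is fixed by scaling with 2, so costs there
   are nonnegative and the factor [alpha] does no harm. *)
have [a_eq0|a_neq0] := eqVneq a 0.
  have -> : t = const_mx a.
    apply/rowP => r; apply/eqP; rewrite eq_le.
    by have := tu r; have := lt r; rewrite !mxE a_eq0 !mulr0 => -> ->.
  have s0 : (const_mx a : 'rV[R]_m) = 2 *: const_mx a.
    by rewrite a_eq0 scalemx_const mulr0.
  have p0 : 0 <= cost p (const_mx a).
    by apply: (@cost_ge0 _ _ _ U _ _ 2) => //; rewrite -?s0//; lra.
  apply: le_trans (ler_peMl p0 a1) _.
  by rewrite ler_wpM2l// (le_trans ler01).
have a_gt0 : 0 < a by rewrite lt_def a_neq0.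
set lb := c^-1 *: const_mx a in lt.
have sE : const_mx a = c *: lb by rewrite scalerA mulfV ?gt_eqF// scale1r.
have slb : is_selectivity lb.
  move=> r; rewrite !mxE mulr_ge0 ?invr_ge0 ?(ltW c0)//=.
  by rewrite (le_trans _ a_le1)// ler_piMl// invf_le1.
have clb : min_cube alpha (const_mx a) lb.
  split=> // r; rewrite ?min_lbE//.
  rewrite !mxE -/c ler_wpM2r// (le_trans _ c1)// invf_le1//.
have Ulb := subU _ clb.
(* Chain: optimality of [p] at the means, sensitivity of [p'] from [lb] up to the means,
   monotonicity from [lb] to [t]. *)
have le1 : cost p (const_mx a) <= c ^+ m * cost p' t.
  apply: (le_trans (optp p')); rewrite {1}sE.
  apply: le_trans (sens p' lb c c1 slb _ Ulb _) _; rewrite -?sE//.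
  by rewrite ler_wpM2l ?exprn_ge0 ?(ltW c0)//; apply: (cost_monotone (q := Q)).
pose f := Num.min c a^-1.
have f1 : 1 <= f by rewrite le_min c1/= invf_ge1.
have f0 : 0 < f by apply: lt_le_trans f1.
have sfs : is_selectivity (f *: const_mx a : 'rV[R]_m).
  move=> r; rewrite !mxE mulr_ge0 ?(ltW f0)//=.
  by rewrite -(@mulVf _ a)// ler_wpM2r// ge_min lexx orbT.
have cfs : min_cube alpha (const_mx a) (f *: const_mx a : 'rV[R]_m).
  split=> // r; rewrite ?min_lbE /min_ub !mxE -/c ler_wpM2r//.
    by apply: (le_trans _ f1); rewrite invf_le1.
  by rewrite ge_min lexx.
have tfs : vle t (f *: const_mx a).
  move=> r; rewrite !mxE.
  (* The two upper bounds on [t], namely [c * a] from the cube and 1 from being a selectivity, match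
     the two cases of the minimum [f]. *)
  have := tu r; have /andP[_] := st r; rewrite !mxE /f.
  by case: (leP c a^-1) => // _; rewrite mulVf.
have le2 : cost p t <= f ^+ m * cost p (const_mx a).
  apply: (le_trans (cost_monotone p st sfs tfs)).
  by apply: sens => //; exact: subU.
(* Weakening [f ^+ m] to [c ^+ m] needs a nonnegative cost, which is derived from a scaling factor
   above 1. For [c = 1] both bounds have factor 1 and chain directly. *)
have [c_eq1|c_neq1] := eqVneq c 1.
  have f_eq1 : f = 1 by apply/le_anti; rewrite f1 /f c_eq1 ge_min lexx.
  have al1 : alpha = 1 by rewrite -cm c_eq1 expr1n mulr1.
  move: le1 le2; rewrite f_eq1 c_eq1 al1 expr1n !mul1r => le1 le2.
  exact: le_trans le2 le1.
have p0 : 0 <= cost p (const_mx a).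
  apply: (@le_trans _ _ (cost p lb)).
    by apply: (@cost_ge0 _ _ _ U _ _ c) => //; rewrite -?sE ?lt_def ?c_neq1.
  apply: (cost_monotone (q := Q)) => // r; rewrite !mxE ler_piMl//.
  by rewrite invf_le1.
apply: (le_trans le2); rewrite -cm -mulrA.
apply: (@le_trans _ _ (c ^+ m * cost p (const_mx a))).
  by rewrite ler_wpM2r// lerXn2r ?nnegrE ?(ltW f0) ?(ltW c0)// ge_min lexx.
by rewrite ler_wpM2l// exprn_ge0// ltW.
Qed.

Definition common_confidence (R : realType) (m l : nat) (d : R) : R :=
  Num.max (1 - 2 * expR (- (2 * d ^+ 2 * l%:R))) 0 ^+ m.

(** The lower bound of the cube is the nearer one: with [c] the upper scaling factor,
    [c - 1 = c * (1 - c^-1)] is at least [1 - c^-1]. Hence every minimal distance is [d]. *)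
Lemma confidence_minimal_cube (R : realType) (m : nat) (Q : query R m)
    (alpha a : R) (it : iteration Q) (l : nat) :
  1 <= alpha -> 0 <= a -> means it = const_mx a ->
  Defs.lbound it = min_lb alpha (const_mx a) ->
  Defs.ubound it = min_ub alpha (const_mx a) ->
  (forall r, size (samples it r) = l) ->
  confidence it
  = common_confidence m l (a * (1 - alpha `^ (- (2 * m%:R)^-1))).
Proof.
move=> a1 a_ge0 meanE lbE ubE sizeE.
set d := a * _.
have distE r : min_dist it r = d.
  rewrite /min_dist meanE lbE ubE min_lbE /min_ub /d powRN !mxE.
  set c := alpha `^ _.
  have c1 : 1 <= c by rewrite powR_ge1// invr_ge0 mulr_ge0.
  have c0 : 0 < c by apply: lt_le_trans c1.
  have ci : c^-1 <= 1 by rewrite invf_le1.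
  rewrite -{1 4}[a]mul1r -!mulrBl !normrM (ger0_norm a_ge0).
  rewrite !ger0_norm ?subr_ge0// [RHS]mulrC; apply/min_idPl.
  rewrite ler_wpM2r//.
  have -> : c - 1 = c * (1 - c^-1) by rewrite mulrBr mulr1 mulfV ?gt_eqF.
  by rewrite ler_peMl// subr_ge0.
rewrite /confidence; under eq_bigr do rewrite distE sizeE.
by rewrite prodr_const card_ord.
Qed.

Lemma sample_number_le (R : realType) (m l : nat) (delta d : R) :
  (0 < m)%N -> 0 < delta <= 1 ->
  (sample_number m delta d <= (m * l)%:R%:E)%E
  = (delta <= common_confidence m l d).
Proof.
move=> m0 /andP[d0 d1]; rewrite /sample_number /common_confidence.
set q := delta `^ _; set e := expR _.
have qm : q ^+ m = delta by rewrite powR_invnK// ltW.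
have q0 : 0 < q by rewrite powR_gt0.
have q1 : q <= 1 by rewrite -(@ler_pXn2r _ m)// ?nnegrE ?(ltW q0)// qm expr1n.
have mR0 : 0 < m%:R :> R by rewrite ltr0n.
have e0 : 0 < e by exact: expR_gt0.
rewrite -{1}qm ler_pXn2r ?nnegrE ?le_max ?lexx ?orbT ?(ltW q0)//.
(* As [delta] is positive, so is its root [q], and truncating the factor at 0 changes nothing. *)
rewrite [q <= 0]leNgt q0 orbF.
(* For [q = 1] the sample number is [+oo], while the factor stays strictly below 1. *)
have [q_eq1|q_neq1] := eqVneq q 1.
  rewrite q_eq1 subrr inve0 gt0_muley ?lte_fin//=.
  rewrite gt0_muley ?lte_fin// gt0_mulye; last first.
    rewrite inver; case: eqP => // /eqP ne.
    by rewrite lte_fin invr_gt0 lt_def ne mulr_ge0// sqr_ge0.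
  by rewrite leye_eq/=; apply/esym/negbTE; rewrite -ltNge; lra.
have q_lt1 : 0 < 1 - q by rewrite subr_gt0 lt_def eq_sym q_neq1.
rewrite [in LHS]inver gt_eqF// -EFinM lne_EFin ?divr_gt0//.
have lnq : 0 < ln (2 / (1 - q)).
  by rewrite ln_gt0// ltr_pdivlMr//; lra.
(* For [d = 0] the sample number is again [+oo], and the untruncated factor is -1. *)
rewrite -EFinM; have [d_eq0|d_neq0] := eqVneq d 0.
  rewrite d_eq0 expr0n mulr0 inve0 gt0_muley ?lte_fin ?mulr_gt0// leye_eq.
  apply/esym/negbTE; rewrite -ltNge /e d_eq0 expr0n mulr0 mul0r oppr0 expR0.
  lra.
have dd : 0 < 2 * d ^+ 2 by rewrite mulr_gt0// exprn_even_gt0.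
rewrite inver gt_eqF// -EFinM lee_fin ler_pdivrMr// natrM -mulrA ler_pM2l//.
rewrite -ler_expR lnK ?posrE ?divr_gt0//.
have -> : (q <= 1 - 2 * e) = (2 * e <= 1 - q) by apply/idP/idP; lra.
rewrite /e expRN [l%:R * _]mulrC.
by rewrite [RHS]ler_pdivrMr ?expR_gt0// ler_pdivrMr// [expR _ * _]mulrC.
Qed.

Theorem theorem2 (R : realType) (m : nat) (Q : query R m)
    (alpha delta a : R) (U : set 'rV[R]_m) (run : nat -> iteration Q) :
  (0 < m)%N -> 1 <= alpha -> 0 <= delta <= 1 ->
  nbhs (selectivity Q) U -> max_sensitive Q U ->
  min_cube alpha (const_mx a) `<=` U ->
  algorithm_run run ->
  establishes_minimal_cubes alpha run ->
  uniform_sampling run ->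
  let d := a * (1 - alpha `^ (- (2 * m%:R)^-1)) in
  let N := sample_number m delta d in
  (* any iteration, in particular the final one, whose means all equal a *)
  (forall k, means (run k) = const_mx a ->
     [/\ established_cube (run k) (means (run k)),
         near_optimal_in alpha (chosen (run k)) (established_cube (run k)),
         (N <= (total_samples (run k))%:R%:E)%E -> delta <= confidence (run k) &
         0 < delta -> delta <= confidence (run k) ->
           (N <= (total_samples (run k))%:R%:E)%E])
  /\
  (* means that stay equal to a: the algorithm returns in the first iteration
     in which the total number of samples reaches N *)
  ((forall k, means (run k) = const_mx a) -> (N < +oo)%E ->
     exists k, [/\ returns_at delta run k,
       forall j, (j < k)%N -> ((total_samples (run j))%:R%:E < N)%E &
       0 < delta -> (N <= (total_samples (run k))%:R%:E)%E]).
Proof.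
move=> m0 a1 /andP[d0 d1] _ sens subU algo minc unif d N.
have conf_ge0 k : 0 <= confidence (run k).
  by apply: prodr_ge0 => r _; rewrite le_max lexx orbT.
(* The equivalence fails for [delta = 0]: every confidence meets that threshold, although [N] is
   still positive. *)
have stop k : means (run k) = const_mx a -> 0 < delta ->
    (N <= (total_samples (run k))%:R%:E)%E = (delta <= confidence (run k)).
  move=> meanE delta0; have [lbE ubE] := minc k; rewrite meanE in lbE ubE.
  have /(_ (Ordinal m0)) := means_is_selectivity (run k).
  rewrite meanE mxE => /andP[a_ge0 _].
  have sizeE r : size (samples (run k) r) = size (samples (run k) (Ordinal m0)).
    exact: unif.
  rewrite (confidence_minimal_cube a1 a_ge0 meanE lbE ubE sizeE).
  rewrite /total_samples (eq_bigr _ (fun r _ => sizeE r)) sum_nat_const card_ord.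
  by rewrite sample_number_le// delta0.
split=> [k meanE|meanE Noo].
  have [lbE ubE] := minc k; have [optk _ _] := algo k.
  have sk := means_is_selectivity (run k).
  rewrite /established_cube lbE ubE; rewrite meanE in optk sk *.
  split.
  - exact: min_cube_center.
  - exact: (optimal_near_optimal m0 a1 sens).
  - move: d0; rewrite le_eqVlt => /orP[/eqP<- _|delta0]; first exact: conf_ge0.
    by rewrite stop.
  - by move=> delta0; rewrite stop.
move: d0; rewrite le_eqVlt => /orP[/eqP delta0|delta0].
  by exists 0%N; split; rewrite -?delta0 ?ltxx//; split=> //; exact: conf_ge0.
(* Each iteration adds at least one sample, so the total eventually passes the finite [N]; the least
   such iteration is the returning one. *)
have reach : exists k, (N <= (total_samples (run k))%:R%:E)%E.
  have grow k : (k <= total_samples (run k))%N.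
    by elim: k => // k IH; have [_ _] := algo k; exact: leq_ltn_trans.
  have [n Nn] : exists n : nat, (N <= n%:R%:E)%E.
    move: Noo; case: (N) => [x _||] //; last by exists 0%N; rewrite leNye.
    by exists (Num.trunc x).+1; rewrite lee_fin ltW// truncnS_gt.
  exists n; apply: (le_trans Nn); rewrite lee_fin ler_nat; exact: grow.
case: (ex_minnP reach) => k Nk mink; exists k.
have below j : (j < k)%N -> ((total_samples (run j))%:R%:E < N)%E.
  by move=> jk; rewrite ltNge; apply/negP => /mink; rewrite leqNgt jk.
split=> //; split; first by rewrite -stop.
by move=> j /below; rewrite !ltNge stop.
Qed.
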